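(* Let $(d_1,\ldots,d_n)$ be a nonempty, nondecreasing sequence of nonnegative integers. Then every digraph on $n$ vertices whose (nondecreasingly ordered) outdegree sequence is $(d_1,\ldots,d_n)$ contains $2$ vertex disjoint cycles if and only if the sequence $(d_1,\ldots,d_n)$ is large, i.e. there exist integers $1\le r\le s\le n$ such that (a) $d_r\ge r$ and $d_s\ge s+1$, and (b) if $n\ge 2s-r+2$ and $d_{2s-r+2}=s+1$, then there is an integer $j\in[2s-r+3,n]$ with $d_j\ge j$.
   Context: Digraphs are finite; they may have loops and 2-cycles (pairs of opposite arcs $x\to y$, $y\to x$) but no parallel arcs. The outdegree of a vertex $x$ is the number of vertices $y$ (possibly $y=x$) with an arc $x\to y$; in particular a loop contributes $1$ to the outdegree. A cycle means a directed cycle; a loop counts as a cycle of length $1$ and a 2-cycle as a cycle of length $2$. The outdegree sequence of a digraph is the list of outdegrees of its vertices arranged in nondecreasing order. (If no digraph has the given outdegree sequence, the statement ''every digraph ... contains 2 vertex disjoint cycles'' holds vacuously.) *)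

(* Defs.v *)
From HB Require Import structures.
From mathcomp Require Import all_boot.

Set Implicit Arguments.
Unset Strict Implicit.
Unset Printing Implicit Defensive.

(* A digraph is a relation [e : rel T] on a finite type: loops and 2-cycles
   are allowed, parallel arcs are excluded. *)

Definition outdeg (T : finType) (e : rel T) (x : T) : nat :=
  #|[set y | e x y]|.

Definition outdeg_seq (T : finType) (e : rel T) : seq nat :=
  sort leq [seq outdeg e x | x : T].

(* [path.ucycle e c] also holds for the empty sequence, hence the first
   conjunct; [:: x] is a dicycle iff x carries a loop. *)
Definition dicycle (T : finType) (e : rel T) (c : seq T) : bool :=
  [&& c != [::], cycle e c & uniq c].

Definition two_disjoint_cycles (T : finType) (e : rel T) : Prop :=
  exists c1 c2 : seq T,
    [/\ dicycle e c1, dicycle e c2 & [disjoint c1 & c2]].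

(* 1-based indexing; only meaningful for 1 <= i <= size d. *)
Definition term (d : seq nat) (i : nat) : nat := nth 0 d i.-1.

(* As r <= s, the subtraction in 2 * s - r is never truncated. *)
Definition large (d : seq nat) : Prop :=
  exists r s : nat,
    [/\ 1 <= r <= s /\ s <= size d,
        r <= term d r /\ s + 1 <= term d s &
        2 * s - r + 2 <= size d -> term d (2 * s - r + 2) = s + 1 ->
        exists2 j : nat, 2 * s - r + 3 <= j <= size d & j <= term d j].

(* Main.v *)
Require Import Defs.
From HB Require Import structures.
From mathcomp Require Import all_boot zify.

(** Disjoint dicycles are replaced by disjoint nonempty sets in which every
vertex has an out-neighbour; call a digraph intercyclic if there are no two.

Key fact: a loopless intercyclic digraph with all outdegrees at least 2 in
which the ends of every arc have a common in-neighbour is a wheel, so all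
vertices but one have outdegree 2.  Indeed, if C is a smallest set as above,
every in-neighbourhood contains such a set, so a source b of the complement of
C has in-neighbourhood exactly C; no second vertex is dominated by C (two
disjoint paths back to C would give two disjoint dicycles), which forces an arc
from b to C.  Hence C is a 2-cycle, and chasing these 2-cycles around yields
the hub and the rim.

For an intercyclic digraph without sinks and with fewer than s vertices of
outdegree at most s, induction on the order shows that more than 2s vertices
have outdegree at most s+1, and more than k have outdegree at most k for
2s < k < n.  An arc whose ends have no common in-neighbour is contracted; so is
an arc leaving a vertex of outdegree at most s, passing from s to s-1.  What
remains is rigid: contracting the whole set of vertices of outdegree at most s
gives a wheel, whose hub has too large an outdegree.  Vertices that reach no
dicycle are discarded beforehand.

Conversely, a sequence that is not large is realised either by a digraph in
which all dicycles pass through one vertex, or by a wheel with acyclic parts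
attached below and above it. *)

Set Implicit Arguments.
Unset Strict Implicit.
Unset Printing Implicit Defensive.

(** * Sets in which every vertex has an out-neighbour *)

Section Digraph.
Variables (T : finType) (e : rel T).
Implicit Types (A B C X Y : {set T}).

(** Contains a dicycle, yet the condition is local: it lifts through contractions and combines with
    tracks without bookkeeping of paths. *)
Definition sinkless A : bool :=
  (A != set0) && [forall x in A, [exists y in A, e x y]].

Definition intercyclic : Prop :=
  forall A B, sinkless A -> sinkless B -> ~~ [disjoint A & B].

Lemma sinklessP A :
  reflect (A != set0 /\ forall x, x \in A -> exists2 y, y \in A & e x y)
          (sinkless A).
Proof.
apply: (iffP andP) => -[A0 sA]; split=> //.
  by move=> x xA; move/forall_inP: sA => /(_ x xA) /exists_inP.
by apply/forall_inP => x xA; apply/exists_inP/sA.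
Qed.

Lemma dicycle_sinkless c : dicycle e c -> sinkless [set x in c].
Proof.
case/and3P=> c0 ce _; apply/sinklessP; split.
  by case: c c0 {ce} => // x c _; apply/set0Pn; exists x; rewrite inE mem_head.
move=> x; rewrite inE => xc; exists (next c x); last exact: next_cycle.
by rewrite inE mem_next.
Qed.

(** Iterating a choice [f] of out-neighbours inside [A] must repeat a vertex; the trajectory from
    that vertex on is the dicycle. *)
Lemma sinkless_dicycle A :
  sinkless A -> exists2 c, dicycle e c & {subset c <= A}.
Proof.
case/sinklessP=> /set0Pn[x xA] sA.
pose f u := if [pick v | (v \in A) && e u v] is Some v then v else u.
have fP u : u \in A -> (f u \in A) && e u (f u).
  move=> uA; rewrite /f; case: pickP => [//|h].
  by have [v vA uv] := sA u uA; have := h v; rewrite vA uv.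
have itA k : iter k f x \in A.
  by elim: k => //= k IH; case/andP: (fP _ IH).
have /trajectP[i lt_i def_i] : iter (fingraph.order f x) f x \in
    traject f x (fingraph.order f x) by exact: looping_order.
set m := fingraph.order f x in lt_i def_i.
have defo : traject f x m = traject f x i ++ traject f (iter i f x) (m - i).
  by rewrite -trajectD subnKC // ltnW.
exists (traject f (iter i f x) (m - i)); last first.
  by move=> y /trajectP[k _ ->]; rewrite -iterD itA.
apply/and3P; split.
- by rewrite -size_eq0 size_traject subn_eq0 -ltnNge.
- have -> : (m - i)%N = (m - i).-1.+1 by rewrite prednK // subn_gt0.
  rewrite trajectS /= -cats1 cat_path /=; apply/andP; split.
    apply: (@sub_in_path _ (mem A) (frel f)).
    + by move=> u v uA _ /eqP <-; case/andP: (fP _ uA).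
    + apply/allP => u; rewrite -trajectS => /trajectP[k _ ->].
      by rewrite -iterD; apply: itA.
    + by apply/fpathP; exists (m - i).-1.
  rewrite last_traject -iterD.
  have -> : iter i f x = f (iter ((m - i).-1 + i) f x).
    by rewrite -iterS -addSn prednK ?subn_gt0 // subnK ?def_i // ltnW.
  by rewrite andbT; case/andP: (fP _ (itA ((m - i).-1 + i))).
- by have := orbit_uniq f x; rewrite /orbit -/m defo cat_uniq => /and3P[].
Qed.

Lemma two_disjoint_cycles_or_intercyclic : two_disjoint_cycles e \/ intercyclic.
Proof.
have [|no2] := boolP [exists A, exists B,
    [&& sinkless A, sinkless B & [disjoint A & B]]].
  case/existsP=> A /existsP[B /and3P[sA sB dAB]]; left.
  have [c1 d1 s1] := sinkless_dicycle sA; have [c2 d2 s2] := sinkless_dicycle sB.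
  exists c1, c2; split=> //.
  rewrite disjoint_has; apply/hasPn => x /s1 xA; apply/negP => /s2 xB.
  by move/pred0P: dAB => /(_ x) /=; rewrite xA xB.
right=> A B sA sB; apply: contra no2 => dAB.
by apply/existsP; exists A; apply/existsP; exists B; rewrite sA sB.
Qed.

Lemma intercyclic_no2 : intercyclic -> ~ two_disjoint_cycles e.
Proof.
move=> ic [c1 [c2 [/dicycle_sinkless d1 /dicycle_sinkless d2 dis]]].
have /negP := ic _ _ d1 d2; apply.
apply/pred0P => x /=; rewrite !inE; apply/negP => /andP[x1 x2].
by move/pred0P: dis => /(_ x) /=; rewrite x1 x2.
Qed.

Definition acyclic_on X : Prop := forall A, A \subset X -> ~~ sinkless A.

Lemma acyclic_onS X Y : Y \subset X -> acyclic_on X -> acyclic_on Y.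
Proof. by move=> sYX aX A sAY; apply: aX; apply: subset_trans sYX. Qed.

Lemma acyclic_sink X : acyclic_on X -> X != set0 ->
  exists2 v, v \in X & forall y, y \in X -> ~~ e v y.
Proof.
move=> aX X0; have := aX X (subxx _); rewrite /sinkless X0 /=.
case/forall_inPn => v vX /exists_inPn h; by exists v.
Qed.

(** Remove a sink [v]: it sends no arc into [X], so a source of the rest is a source of [X]. *)
Lemma acyclic_source X : acyclic_on X -> X != set0 ->
  exists2 v, v \in X & forall y, y \in X -> ~~ e y v.
Proof.
have [k] := ubnP #|X|; elim: k X => // k IH X leXk aX X0.
have [v vX vs] := acyclic_sink aX X0.
have [Xv0|Xv0] := eqVneq (X :\ v) set0.
  exists v => // y yX; have [->|yv] := eqVneq y v; first exact: vs.
  by have := in_set0 y; rewrite -Xv0 !inE yv yX.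
have [|w] := IH (X :\ v) _ (acyclic_onS (subsetDl _ _) aX) Xv0.
  by have := cardsD1 v X; rewrite vX; lia.
rewrite !inE => /andP[wv wX] ws; exists w => // y yX.
have [->|yv] := eqVneq y v; first exact: vs.
by apply: ws; rewrite !inE yv.
Qed.

Lemma sourceless_sinkless X : X != set0 ->
  (forall v, v \in X -> exists2 y, y \in X & e y v) ->
  exists2 A : {set T}, A \subset X & sinkless A.
Proof.
move=> X0 inX.
have [/existsP[A /andP[sAX sA]]|] := boolP [exists A : {set T}, (A \subset X) && sinkless A].
  by exists A.
rewrite negb_exists => /forallP h.
have aX : acyclic_on X by move=> A sAX; have := h A; rewrite sAX.
have [v vX vs] := acyclic_source aX X0.
by have [y yX yv] := inX v vX; rewrite (negPf (vs y yX)) in yv.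
Qed.

Lemma intercyclic_acyclic C : intercyclic -> sinkless C -> acyclic_on (~: C).
Proof.
move=> ic sC A sAC; apply/negP => sA.
by have /negP := ic _ _ sA sC; apply; rewrite disjoints_subset.
Qed.

(* Tokens start at [a] and [b]; the one closer to the sources of [X] moves on,
   to an out-neighbour not occupied by the other one, so that the two tracks
   stay disjoint.  This replaces an appeal to Menger's theorem. *)
Lemma acyclic_link X Y a b : X \subset Y -> acyclic_on X -> a != b ->
  a \in Y -> b \in Y ->
  (forall v, v \in X -> 1 < outdeg e v) ->
  (forall v y, v \in X -> e v y -> y \in Y) ->
  exists A B : {set T}, [/\ a \in A, b \in B, [disjoint A & B] /\ A :|: B \subset Y,
    forall v, v \in X -> v \in A -> exists2 y, y \in A & e v y &
    forall v, v \in X -> v \in B -> exists2 y, y \in B & e v y].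
Proof.
have [k] := ubnP #|X|; elim: k X Y a b => // k IH X Y a b leXk sXY aX ab aY bY dX nX.
have [X0|X0] := eqVneq X set0.
  exists [set a], [set b]; split; rewrite ?set11 //.
  - by rewrite disjoints1 inE subUset !sub1set aY.
  - by move=> v; rewrite X0 in_set0.
  - by move=> v; rewrite X0 in_set0.
have [t tX ts] := acyclic_source aX X0.
have ltX : #|X :\ t| < k by have := cardsD1 t X; rewrite tX; lia.
have dX' v : v \in X :\ t -> 1 < outdeg e v by rewrite inE => /andP[_ /dX].
(* No arc from [X] enters its source [t], so no track returns to [t] and the induction may drop it
   from both [X] and [Y]. *)
have nX' v y : v \in X -> e v y -> y \in Y :\ t.
  move=> vX vy; rewrite !inE (nX v y vX vy) andbT.
  by apply: contraTneq vy => ->; apply: ts.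
have nX'' v y : v \in X :\ t -> e v y -> y \in Y :\ t.
  by rewrite inE => /andP[_ vX]; apply: nX'.
have IHt c d := IH (X :\ t) (Y :\ t) c d ltX (setSD _ sXY)
  (acyclic_onS (subsetDl _ _) aX).
have step d : t != d -> d \in Y ->
  exists A B : {set T}, [/\ t \in A, d \in B, [disjoint A & B] /\ A :|: B \subset Y,
    forall v, v \in X -> v \in A -> exists2 y, y \in A & e v y &
    forall v, v \in X -> v \in B -> exists2 y, y \in B & e v y].
  move=> td dY.
  have [c tc cd] : exists2 c, e t c & c != d.
    have := dX t tX; rewrite /outdeg (cardsD1 d) => lt1.
    have /card_gt0P[c] : 0 < #|[set y | e t y] :\ d|.
      by move: lt1; case: (d \in _); lia.
    by rewrite !inE => /andP[cd tc]; exists c.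
  have dY' : d \in Y :\ t by rewrite !inE (eq_sym d t) td.
  have [A [B [cA dB [dAB sAB] lA lB]]] := IHt c d cd (nX' t c tX tc) dY' dX' nX''.
  have tAB : t \notin A :|: B.
    by apply/negP => /(subsetP sAB); rewrite !inE eqxx.
  exists (t |: A), B; split; rewrite ?setU11 //.
  - split; last first.
      rewrite -setUA subUset sub1set (subsetP sXY) //=.
      exact: subset_trans sAB (subsetDl _ _).
    rewrite disjoints_subset subUset sub1set -disjoints_subset dAB andbT inE.
    by apply: contra tAB => tB; rewrite inE tB orbT.
  - move=> v vX; rewrite !inE => /orP[/eqP->|vA].
      by exists c => //; rewrite inE cA orbT.
    have vt : v != t by apply: contraNneq tAB => <-; rewrite inE vA.
    by have [|y yA vy] := lA v _ vA; [rewrite !inE vt | exists y; rewrite // inE yA orbT].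
  - move=> v vX vB.
    have vt : v != t by apply: contraNneq tAB => <-; rewrite inE vB orbT.
    by apply: lB; rewrite // !inE vt.
have [ta|ta] := eqVneq t a; first by rewrite -ta; apply: step; rewrite // ta.
have [tb|tb] := eqVneq t b.
  have [|A [B [tA aB [dAB sAB] lA lB]]] := step a _ aY; first by rewrite tb eq_sym.
  by exists B, A; rewrite -tb disjoint_sym setUC.
have [||A [B [aA bB [dAB sAB] lA lB]]] := IHt a b ab _ _ dX' nX''.
- by rewrite !inE (eq_sym a) ta.
- by rewrite !inE (eq_sym b) tb.
have tAB : t \notin A :|: B.
  by apply/negP => /(subsetP sAB); rewrite !inE eqxx.
rewrite inE negb_or in tAB; case/andP: tAB => tA tB.
exists A, B; split=> //; first by split=> //; exact: subset_trans sAB (subsetDl _ _).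
- move=> v vX vA; apply: lA; rewrite // !inE vX andbT.
  by apply: contraNneq tA => <-.
- move=> v vX vB; apply: lB; rewrite // !inE vX andbT.
  by apply: contraNneq tB => <-.
Qed.

(** Otherwise disjoint tracks from [a] and [b] run through the acyclic complement of [C]; wherever
    they meet [C], an arc leads back to their own start, so both are sinkless. *)
Lemma intercyclic_dominated C a b : intercyclic ->
  (forall v, 1 < outdeg e v) -> sinkless C -> a \notin C -> b \notin C ->
  (forall c, c \in C -> e c a && e c b) -> a = b.
Proof.
move=> ic dT sC aC bC dom; apply/eqP; apply: contraT => ab.
have aX := intercyclic_acyclic ic sC.
have [A [B [aA bB [dAB _] lA lB]]] :=
  @acyclic_link (~: C) setT a b (subsetT _) aX ab (in_setT _) (in_setT _)
    (fun v _ => dT v) (fun v y _ _ => in_setT y).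
have sA : sinkless A.
  apply/sinklessP; split; first by apply/set0Pn; exists a.
  move=> v vA; have [vC|vC] := boolP (v \in C).
    by exists a => //; case/andP: (dom v vC).
  by apply: lA; rewrite // inE.
have sB : sinkless B.
  apply/sinklessP; split; first by apply/set0Pn; exists b.
  move=> v vB; have [vC|vC] := boolP (v \in C).
    by exists b => //; case/andP: (dom v vC).
  by apply: lB; rewrite // inE.
by have := ic A B sA sB; rewrite dAB.
Qed.

Lemma two_cycle_sinkless u v : e u v -> e v u -> sinkless [set u; v].
Proof.
move=> uv vu; apply/sinklessP; split; first by apply/set0Pn; exists u; rewrite set21.
by move=> x /set2P[]->; [exists v; rewrite ?set22 | exists u; rewrite ?set21].
Qed.

Lemma sinkless_card_gt1 A : irreflexive e -> sinkless A -> 1 < #|A|.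
Proof.
move=> eI /sinklessP[/set0Pn[x xA] sA]; have [y yA xy] := sA x xA.
by apply/card_gt1P; exists x, y; split=> //; apply: contraTneq xy => ->; rewrite eI.
Qed.

Lemma outdeg_gt1 v w : 1 < outdeg e v -> exists2 y, e v y & y != w.
Proof.
rewrite /outdeg (cardsD1 w) => lt1.
have /card_gt0P[c] : 0 < #|[set y | e v y] :\ w|.
  by move: lt1; case: (w \in _); lia.
by case/setD1P=> cw; rewrite inE => vc; exists c.
Qed.

Lemma smallest_sinkless_in_neighbourhood C : intercyclic -> irreflexive e ->
  (forall v, 1 < outdeg e v) ->
  (forall p q, e p q -> exists2 z, e z p & e z q) ->
  sinkless C -> (forall A, sinkless A -> #|C| <= #|A|) ->
  exists2 b, [set p | e p b] = C & exists2 c, c \in C & e b c.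
Proof.
move=> ic eI dT com sC minC.
(* A common in-neighbour of [v] and [q] lies again among the in-neighbours of [q], so these have no
   source. *)
have nin q : exists2 A : {set T}, A \subset [set p | e p q] & sinkless A.
  apply: sourceless_sinkless.
    have [y qy _] := outdeg_gt1 q (dT q); have [z zq _] := com q y qy.
    by apply/set0Pn; exists z; rewrite inE.
  move=> v; rewrite inE => vq; have [z zv zq] := com v q vq.
  by exists z; rewrite ?inE.
have aX := intercyclic_acyclic ic sC.
have eqC A : sinkless A -> A \subset C -> A = C.
  by move=> sA sAC; apply/eqP; rewrite eqEcard sAC minC.
have [CT|X0] := eqVneq (~: C) set0.
  case/sinklessP: sC => /set0Pn[v vC] _; have [A sAv sA] := nin v.
  have AC : A = C.
    apply: eqC => //; apply/subsetP => x _.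
    by have := in_set0 x; rewrite -CT inE => /negbFE.
  by have := subsetP sAv v; rewrite AC inE eI => /(_ vC).
have [b bC bs] := acyclic_source aX X0.
have Nb : [set p | e p b] = C.
  have sNC : [set p | e p b] \subset C.
    apply/subsetP => p; rewrite inE => pb; apply: contraLR pb => pC.
    by apply: bs; rewrite inE.
  have [A sAN sA] := nin b; apply/eqP; rewrite eqEsubset sNC.
  by rewrite -(eqC A sA (subset_trans sAN sNC)).
exists b => //; have [Xb0|Xb0] := eqVneq ((~: C) :\ b) set0.
  have [c bc cb] := outdeg_gt1 b (dT b); exists c => //.
  by have := in_set0 c; rewrite -Xb0 !inE cb => /negbFE.
(* All in-neighbours of this second source lie in [b |: C]. A sinkless set of them either contains
   [b], giving an arc from [b] to [C], or equals [C], which then dominates both [a] and [b]. *)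
have [a aXb as_] := acyclic_source (acyclic_onS (subsetDl _ _) aX) Xb0.
have [A sAN sA] := nin a.
have sAC : A \subset b |: C.
  apply/subsetP => p /(subsetP sAN); rewrite inE => pa; apply: contraLR pa => pbC.
  by apply: as_; move: pbC; rewrite !inE negb_or.
have [bA|bA] := boolP (b \in A).
  case/sinklessP: sA => _ /(_ b bA)[y yA by_]; exists y => //.
  have /setU1P[yb|//] := subsetP sAC y yA.
  by rewrite yb eI in by_.
have AC : A = C.
  apply: eqC => //; apply/subsetP => x xA; have /setU1P[xb|//] := subsetP sAC x xA.
  by rewrite -xb xA in bA.
case/setD1P: aXb => ab aC; case/eqP: ab.
rewrite !inE in aC bC; apply: (intercyclic_dominated ic dT sC aC bC).
move=> c cC; have := subsetP sAN c; rewrite AC inE => /(_ cC) ->.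
by move: cC; rewrite -Nb inE => ->.
Qed.

Lemma common_in_neighbours_wheel : intercyclic -> irreflexive e ->
  (forall v, 1 < outdeg e v) ->
  (forall p q, e p q -> exists2 z, e z p & e z q) -> 0 < #|T| ->
  exists p, forall v, v != p -> outdeg e v <= 2.
Proof.
move=> ic eI dT com T0.
have eN u v : e u v -> u != v by apply: contraTneq => ->; rewrite eI.
have sT : sinkless setT.
  apply/sinklessP; split; first by rewrite -card_gt0 cardsT.
  by move=> v _; have [y vy _] := outdeg_gt1 v (dT v); exists y.
have [C sC minC] := arg_minnP (fun A : {set T} => #|A|) sT.
have [b0 Nb0 [p0 p0C bp0]] := smallest_sinkless_in_neighbourhood ic eI dT com sC minC.
have pb0 : e p0 b0 by move: p0C; rewrite -Nb0 inE.
(* Without loops a 2-cycle is a smallest sinkless set, so the preceding lemma applies to every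
   2-cycle. *)
have step u v : e u v -> e v u ->
    exists2 b, [set p | e p b] = [set u; v] & e b u \/ e b v.
  move=> uv vu; have sD := two_cycle_sinkless uv vu.
  have [|b Nb [c /set2P[]->]] := smallest_sinkless_in_neighbourhood ic eI dT com sD.
  - by move=> A /(sinkless_card_gt1 eI); rewrite cards2; case: (_ != _); lia.
  - by exists b; first done; left.
  - by exists b; first done; right.
have [p [q [b [pq qp pb bp qb]]]] :
    exists p q b, [/\ e p q, e q p, e p b, e b p & q != b].
  have [b Nb bpb] := step _ _ bp0 pb0.
  have ub u : (e u b) = (u \in [set b0; p0]) by rewrite -Nb inE.
  have bb : e b0 b by rewrite ub set21.
  have pb : e p0 b by rewrite ub set22.
  by case: bpb => ?; [exists b0, p0, b | exists p0, b0, b]; split=> //; apply: eN.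
pose G := [set v | e p v && e v p].
have qG : q \in G by rewrite inE pq.
have bG : b \in G by rewrite inE pb.
(* [p] will be the hub and [G] the rim. If [w] had its arc to [v] but none to [p], the 2-cycle on
   [w], [v] would miss the one on [p] and another [v'] in [G]. *)
have next v : v \in G -> exists w, ([set u | e u w] == [set p; v]) && e w p.
  rewrite inE => /andP[pv vp]; have [w Nw ewp] := step p v pv vp.
  exists w; rewrite Nw eqxx /=; case: ewp => // wv.
  have uw u : (e u w) = (u \in [set p; v]) by rewrite -Nw inE.
  have pw : e p w by rewrite uw set21.
  have vw : e v w by rewrite uw set22.
  apply: contraT => wp.
  have [v' v'G v'v] : exists2 v', v' \in G & v' != v.
    by have [qv|] := eqVneq q v; [exists b; rewrite // -qv eq_sym | exists q].
  move: v'G; rewrite inE => /andP[pv' v'p].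
  have v'w : v' != w by apply: contraNneq wp => <-.
  have /negP[] := ic _ _ (two_cycle_sinkless pv' v'p) (two_cycle_sinkless wv vw).
  rewrite disjoints_subset; apply/subsetP => x /set2P[]->; rewrite !inE negb_or.
    by rewrite !eN.
  by rewrite v'w.
(* The successor on the rim; the default is never taken on [G]. The in-neighbourhood of [f v]
   determines [v], so [f] permutes [G]. *)
pose f v := odflt v [pick w | ([set u | e u w] == [set p; v]) && e w p].
have fP v : v \in G -> [set u | e u (f v)] = [set p; v] /\ e (f v) p.
  rewrite /f => /next[w wP]; case: pickP => [x /andP[/eqP Nx xp]|/(_ w)]; last by rewrite wP.
  by [].
have fN v u : v \in G -> e u (f v) = (u \in [set p; v]).
  by move=> /fP[<-]; rewrite inE.
have fG v : v \in G -> f v \in G.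
  by move=> vG; rewrite inE (fN v p vG) set21; case: (fP v vG).
have f_inj : {in G &, injective f}.
  move=> u v uG vG fuv; have := fN v u vG; rewrite -fuv (fN u u uG) set22.
  move/esym/set2P => [up|//]; by move: uG; rewrite up inE eI.
have imG : f @: G = G.
  apply/eqP; rewrite eqEcard card_in_imset // leqnn andbT.
  by apply/subsetP => _ /imsetP[v vG ->]; apply: fG.
(* Vertices of [G] have in-neighbours only in [p |: G], so the vertices outside [p |: G] would form
   a sinkless set missing the 2-cycle on [p], [q]. *)
have defV v : v != p -> v \in G.
  move=> vp; apply: contraT => vG.
  have sO : sinkless (~: (p |: G)).
    apply/sinklessP; split.
      by apply/set0Pn; exists v; rewrite in_setC in_setU1 negb_or vp.
    move=> o; rewrite in_setC in_setU1 negb_or => /andP[op oG].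
    have [y oy yp] := outdeg_gt1 p (dT o); exists y => //.
    rewrite in_setC in_setU1 negb_or yp; apply: contra oG; rewrite -imG.
    case/imsetP=> w wG yw; move: oy; rewrite yw fN // in_set2 (negPf op) => /eqP ->.
    by rewrite imG.
  have /negP[] := ic _ _ (two_cycle_sinkless pq qp) sO.
  rewrite disjoints_subset setCK; apply/subsetP => x.
  by case/set2P=> ->; rewrite in_setU1 ?eqxx ?qG ?orbT.
exists p => v vp; rewrite /outdeg.
apply: leq_trans (_ : #|[set p; f v]| <= 2); last by rewrite cards2; case: (_ != _).
apply: subset_leq_card; apply/subsetP => y; rewrite inE => vy.
rewrite in_set2; have [//|yp] := eqVneq y p.
have := defV y yp; rewrite -imG => /imsetP[w wG yw].
by move: vy; rewrite yw fN // in_set2 (negPf vp) => /eqP ->; rewrite eqxx orbT.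
Qed.

(** The sorted sequence enters only through these counts: its [i]-th term is at most [k] iff the
    count for [k] is at least [i]. *)
Definition num_outdeg_le k : nat := #|[set v | outdeg e v <= k]|.

End Digraph.

(** * Contraction *)

Section Contraction.
Variables (T : finType) (e : rel T) (rho : T -> T).
Hypothesis rho_idem : forall x, rho (rho x) = rho x.
Hypothesis rho_arc : forall x, rho x != x -> exists2 z, e x z & rho z = rho x.

(* The fixed points of [rho] represent the classes being contracted. *)
Definition contract_vertex := {v : T | rho v == v}.
HB.instance Definition _ := Finite.on contract_vertex.

(** Arcs leaving non-representatives are dropped, so a class has the outdegree of its
    representative, up to heads that become identified. *)
Definition contract (u v : contract_vertex) : bool :=
  [exists w, e (val u) w && (rho w == val v)].

(** By [rho_arc] a non-representative has an out-neighbour in its own class; a representative uses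
    an arc of the contraction. *)
Lemma sinkless_preim (A : {set contract_vertex}) :
  sinkless contract A -> sinkless e [set v | rho v \in val @: A].
Proof.
case/sinklessP=> /set0Pn[x xA] sA; apply/sinklessP; split.
  by apply/set0Pn; exists (val x); rewrite inE (eqP (valP x)) imset_f.
move=> v; rewrite inE; have [rv|rv] := eqVneq (rho v) v; last first.
  by have [z vz rz] := rho_arc rv; exists z; rewrite // inE rz.
rewrite rv => /imsetP[u uA vu]; have [y yA /existsP[w /andP[uw /eqP wy]]] := sA u uA.
by exists w; rewrite ?vu // inE wy imset_f.
Qed.

Lemma intercyclic_contract : intercyclic e -> intercyclic contract.
Proof.
move=> ic A B /sinkless_preim sA /sinkless_preim sB.
apply: contra (ic _ _ sA sB) => dAB.
rewrite disjoints_subset; apply/subsetP => v; rewrite !inE => /imsetP[a aA ->].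
rewrite mem_imset //; last exact: val_inj.
by move/pred0P: dAB => /(_ a) /=; rewrite aA /= => ->.
Qed.

Lemma outdeg_contract u :
  outdeg contract u = #|rho @: [set w | e (val u) w]|.
Proof.
rewrite /outdeg -(card_imset _ val_inj); apply: eq_card => v.
apply/imsetP/imsetP => [[y]|[w]].
  by rewrite inE => /existsP[w /andP[uw /eqP wy]] ->; exists w; rewrite ?inE ?wy.
rewrite inE => uw vw; have rv : rho v == v by rewrite vw rho_idem.
by exists (exist _ v rv); rewrite // inE; apply/existsP; exists w; rewrite uw /= -vw.
Qed.

Lemma card_contract_vertex (P : pred T) :
  #|[set v : contract_vertex | P (val v)]| = #|[set v | (rho v == v) && P v]|.
Proof.
rewrite -(card_imset _ val_inj); apply: eq_card => v.
apply/imsetP/idP => [[y]|]; first by rewrite !inE => Py ->; rewrite (valP y).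
by rewrite inE => /andP[rv Pv]; exists (exist _ v rv); rewrite // inE.
Qed.

End Contraction.

Section Retraction.
Variables (T : finType) (e : rel T).

(** Follow chosen out-neighbours until [S] is left: an orbit staying in [S] would be sinkless, and
    [#|T|] steps suffice. *)
Lemma acyclic_retraction (S : {set T}) : acyclic_on e S ->
  (forall v, 0 < outdeg e v) ->
  exists rho : T -> T, [/\ forall v, rho v \notin S,
    forall v, v \notin S -> rho v = v &
    forall v, v \in S -> exists2 z, e v z & rho z = rho v].
Proof.
move=> aS dT.
pose g v := if v \in S then odflt v [pick y | e v y] else v.
have gS v : v \notin S -> g v = v by rewrite /g => /negPf ->.
have eg v : v \in S -> e v (g v).
  rewrite /g => ->; case: pickP => // h; have /card_gt0P[y] := dT v.
  by rewrite inE h.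
have itS k v : v \notin S -> iter k g v = v.
  by move=> vS; elim: k => //= k ->; apply: gS.
have rS v : iter #|T| g v \notin S.
  have [sAS|] := boolP ([set w | fconnect g v w] \subset S); last first.
    case/subsetPn => w; rewrite inE => vw wS.
    have /subnK <- : findex g v w <= #|T|.
      by rewrite ltnW // (leq_trans (findex_max vw)) // max_card.
    by rewrite iterD iter_findex // itS.
  have /negP[] := aS _ sAS; apply/sinklessP; split.
    by apply/set0Pn; exists v; rewrite inE connect0.
  move=> w wA; exists (g w); last by apply/eg/(subsetP sAS).
  by move: wA; rewrite !inE => vw; apply: connect_trans vw (fconnect1 _ _).
exists (iter #|T| g); split=> // [v|v vS]; first exact: itS.
by exists (g v); rewrite ?eg // -iterSr iterS gS.
Qed.

Lemma num_outdeg_leS k l : k <= l -> num_outdeg_le e k <= num_outdeg_le e l.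
Proof.
move=> kl; apply: subset_leq_card; apply/subsetP => v; rewrite !inE => h.
exact: leq_trans kl.
Qed.

(* Otherwise the vertices outside [A] of outdegree more than [s] would have a
   sink, all of whose out-neighbours lie among at most [s] vertices. *)
Lemma sinkless_gt1_large s A : intercyclic e -> s <= #|T| ->
  num_outdeg_le e s < s -> sinkless e A ->
  1 < #|A :\: [set v | outdeg e v <= s]|.
Proof.
set S := [set v | _] => ic sT Ss sA; rewrite ltnNge; apply/negP => leA.
(* At most [s - 1] vertices in [S], and at most one more in [A]. *)
have cAS : #|A :|: S| <= s.
  move: leA Ss; rewrite cardsU cardsD /num_outdeg_le -/S.
  by have := subset_leq_card (subsetIl A S); lia.
have aX := intercyclic_acyclic ic sA.
have [X0|X0] := eqVneq (~: (A :|: S)) set0.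
  have cT : #|T| <= s.
    by rewrite -cardsT; apply: leq_trans cAS; apply: subset_leq_card; rewrite -[A :|: S]setCK X0 setC0.
  suff : #|S| = #|T| by move: Ss; rewrite /num_outdeg_le -/S; lia.
  rewrite -cardsT; congr #|pred_of_set _|; apply/setP => v; rewrite !inE.
  exact: leq_trans (max_card _) cT.
have [|v vX vs] := acyclic_sink (acyclic_onS _ aX) X0.
  by rewrite setCS subsetUl.
move: vX; rewrite !inE negb_or -ltnNge => /andP[_]; rewrite ltnNge; case/negP.
apply: leq_trans cAS; apply: subset_leq_card; apply/subsetP => y; rewrite inE => vy.
by apply: contraLR vy => yAS; apply: vs; rewrite inE.
Qed.

End Retraction.

Section Merge.
Variables (T : finType) (x y : T).
Hypothesis xy : x != y.

Definition merge v := if v == x then y else v.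

Lemma merge_idem v : merge (merge v) = merge v.
Proof. by rewrite /merge; have [|/negPf->//] := eqVneq v x; rewrite eq_sym (negPf xy). Qed.

Lemma merge_fix v : (merge v == v) = (v != x).
Proof. by rewrite /merge; have [->|] := eqVneq v x; rewrite ?eqxx // eq_sym (negPf xy). Qed.

Lemma card_merge_le (N : {set T}) : #|N| <= #|merge @: N|.+1.
Proof.
rewrite (cardsD1 x N); suff: #|N :\ x| <= #|merge @: N| by case: (x \in N) => /=; lia.
apply: subset_leq_card; apply/subsetP => v /setD1P[vx vN].
by apply/imsetP; exists v; rewrite // /merge (negPf vx).
Qed.

(** With [N] an out-neighbourhood: contracting the arc lowers the outdegree only of common
    in-neighbours of its ends. *)
Lemma card_merge_lt (N : {set T}) : #|merge @: N| < #|N| -> (x \in N) && (y \in N).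
Proof.
apply: contraTT => h; rewrite -leqNgt card_in_imset // => u v uN vN.
rewrite /merge; have [ux|ux] := eqVneq u x; have [vx|vx] := eqVneq v x; rewrite ?ux ?vx //.
  by move=> yv; rewrite -yv -ux uN in vN h; rewrite vN in h.
by move=> uy; rewrite -uy -vx vN uN in h.
Qed.

End Merge.

(** * Outdegrees in intercyclic digraphs *)

Lemma outdeg_bounds (T : finType) (e : rel T) s : intercyclic e ->
  (forall v, 0 < outdeg e v) -> s <= #|T| -> num_outdeg_le e s < s ->
  2 * s < num_outdeg_le e s.+1 /\
  forall k, 2 * s < k < #|T| -> k < num_outdeg_le e k.
Proof.
have [n] := ubnP #|T|; elim: n T e s => // n IH T e s leTn ic dT sT Ss.
pose S := [set v | outdeg e v <= s].
have Sc : #|S| < s by [].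
have P A : sinkless e A -> 1 < #|A :\: S| by apply: sinkless_gt1_large.
have eI : irreflexive e.
  move=> v; apply/negP => vv.
  have /P : sinkless e [set v] by rewrite -(setUid [set v]); apply: two_cycle_sinkless.
  by rewrite ltnNge (leq_trans (subset_leq_card (subsetDl _ _))) ?cards1.
have eN u v : e u v -> u != v by apply: contraTneq => ->; rewrite eI.
have leD v : outdeg e v < #|T|.
  have : outdeg e v <= #|[set~ v]|.
    by apply: subset_leq_card; apply/subsetP => y; rewrite !inE eq_sym; apply: eN.
  have : 0 < #|T| by apply/card_gt0P; exists v.
  by rewrite cardsC1; lia.
have numT k : #|T| <= k.+1 -> num_outdeg_le e k = #|T|.
  move=> Tk; rewrite -cardsT; congr #|pred_of_set _|; apply/setP => v; rewrite !inE.
  by rewrite -ltnS (leq_trans (leD v)).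
have s0 : 0 < s by apply: leq_ltn_trans Sc.
have TS : s.+1 < #|T|.
  have [v vS] : exists v, v \notin S.
    have : 0 < #|~: S| by have := cardsC S; lia.
    by case/card_gt0P => v; rewrite inE; exists v.
  by move: vS; rewrite inE -ltnNge => vS; apply: leq_trans (leD v).
have cardV x y (xy : x != y) : e x y ->
    #|{: contract_vertex (merge x y)}| = #|T|.-1.
  move=> exy; rewrite -(cardsC1 x) -cardsT.
  rewrite -(card_imset _ val_inj); apply: eq_card => v; rewrite !inE.
  apply/imsetP/idP => [[w _ ->]|vx]; first by rewrite -(merge_fix xy) (valP w).
  by rewrite -(merge_fix xy) in vx; exists (exist _ v vx).
have icV x y (xy : x != y) : e x y -> intercyclic (@contract T e (merge x y)).
  move=> exy; apply: intercyclic_contract ic => v.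
  rewrite merge_fix // negbK => /eqP ->; exists y => //.
  by rewrite /merge eqxx; case: ifP.
have numV x y (xy : x != y) k : num_outdeg_le (@contract T e (merge x y)) k =
    #|[set v | (v != x) && (#|merge x y @: [set w | e v w]| <= k)]|.
  rewrite -(eq_card (A := [set v | (merge x y v == v) && (#|merge x y @: [set w | e v w]| <= k)])).
    rewrite -(card_contract_vertex (merge x y) (fun v => #|merge x y @: [set w | e v w]| <= k)).
    apply: eq_card => v; rewrite !inE outdeg_contract //; exact: merge_idem.
  by move=> v; rewrite !inE merge_fix.
have dV x y (xy : x != y) v : 0 < outdeg (@contract T e (merge x y)) v.
  rewrite outdeg_contract; last exact: merge_idem.
  by have /card_gt0P[w vw] := dT (val v); apply/card_gt0P; exists (merge x y w); apply: imset_f.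
have [/existsP[x /existsP[y /andP[exy nocom]]]|com] := boolP
    [exists x, exists y, e x y && [forall z, ~~ (e z x && e z y)]].
  have xy := eN _ _ exy.
  have out_eq v : #|merge x y @: [set w | e v w]| = outdeg e v.
    apply/eqP; rewrite eqn_leq leq_imset_card leqNgt; apply/negP => /card_merge_lt.
    by rewrite !inE; apply/negP/(forallP nocom).
  have numle k : num_outdeg_le (@contract T e (merge x y)) k <= num_outdeg_le e k.
    rewrite numV //; apply: subset_leq_card; apply/subsetP => v; rewrite !inE out_eq.
    by case/andP.
  have [|||b1 b2] := IH _ (@contract T e (merge x y)) s _ (icV x y xy exy) (dV x y xy) _ _.
  - by rewrite (cardV x y xy exy); lia.
  - by rewrite (cardV x y xy exy); lia.
  - exact: leq_ltn_trans (numle s) Ss.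
  split; first exact: leq_trans (numle _).
  (* The contraction has one vertex less, so [k = #|T|.-1] escapes the induction; there looplessness
     bounds every outdegree by [k]. *)
  move=> k /andP[sk kT]; have [kT1|kT1] := ltnP k #|T|.-1.
    by apply: leq_trans (numle k); apply: b2; rewrite sk (cardV x y xy exy).
  by rewrite numT //; lia.
have {}com p q : e p q -> exists2 z, e z p & e z q.
  move=> pq; move: com; rewrite negb_exists => /forallP/(_ p).
  rewrite negb_exists => /forallP/(_ q); rewrite pq /= => /forallPn[z].
  by rewrite negbK => /andP[zp zq]; exists z.
(* With [S] empty all outdegrees exceed [s >= 1]; the digraph is a wheel, and a rim vertex, of
   outdegree at most 2, forces [s = 1]. *)
have [S0|/set0Pn[x0 x0S]] := eqVneq S set0.
  have d2 v : s < outdeg e v.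
    by have := in_set0 v; rewrite -S0 inE => /negbT; rewrite -ltnNge.
  have [||p pP] := common_in_neighbours_wheel ic eI _ com.
  - by move=> v; apply: leq_trans (d2 v).
  - exact: leq_trans TS.
  have num2 : #|T|.-1 <= num_outdeg_le e 2.
    rewrite -(cardsC1 p); apply: subset_leq_card; apply/subsetP => v.
    by rewrite !inE; apply: pP.
  have s1 : s = 1.
    have /card_gt0P[v] : 0 < #|[set~ p]| by rewrite cardsC1; lia.
    by rewrite !inE => /pP; have := d2 v; lia.
  rewrite s1; have n2 k : 2 < k.+1 -> k < #|T| -> 2 < k.+1 -> k < num_outdeg_le e k.
    move=> k2 kT _; have [?|?] := leqP #|T| k.+1; first by rewrite numT.
    by apply: leq_trans (num_outdeg_leS e (k2 : 2 <= k)); apply: leq_trans num2; lia.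
  by split=> [|k /andP[? ?]]; apply: n2; lia.
(* Contracting [x] into [y] removes [x] and lowers outdegrees by at most 1, so the induction applies
   with [s.-1]; counting [x] again gives [2 * s], one short of the goal. *)
have red x y : x \in S -> e x y ->
    [/\ forall k, 2 * s < k < #|T| -> k < num_outdeg_le e k,
        2 * s <= num_outdeg_le e s.+1 &
        num_outdeg_le e s.+1 <= 2 * s ->
        forall u, outdeg e u = s.+1 -> e u x && e u y].
  move=> xS exy; have xy := eN _ _ exy.
  have s1 : 1 < s by apply: leq_ltn_trans Sc; apply/card_gt0P; exists x.
  have dx : outdeg e x <= s by rewrite inE in xS.
  have numD k : outdeg e x <= k ->
      num_outdeg_le e k = #|[set v | (v != x) && (outdeg e v <= k)]|.+1.
    move=> xk; rewrite /num_outdeg_le (cardsD1 x) inE xk; congr _.+1.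
    by apply: eq_card => v; rewrite !inE.
  have numle k : num_outdeg_le (@contract T e (merge x y)) k <=
      #|[set v | (v != x) && (outdeg e v <= k.+1)]|.
    rewrite numV //; apply: subset_leq_card; apply/subsetP => v; rewrite !inE.
    case/andP=> -> h /=; apply: (leq_trans (card_merge_le xy [set w | e v w])).
    by rewrite ltnS.
  have [|||b1 b2] := IH _ (@contract T e (merge x y)) s.-1 _ (icV x y xy exy) (dV x y xy) _ _.
  - by rewrite (cardV x y xy exy); lia.
  - by rewrite (cardV x y xy exy); lia.
  - by have := numle s.-1; have := numD s dx; rewrite prednK //; lia.
  rewrite prednK // in b1; have ns := numle s; have nsD := numD s.+1 (leqW dx).
  split.
  - move=> k /andP[sk kT]; have kx : outdeg e x <= k by lia.
    have := numle k.-1; have := numD k kx; have := b2 k.-1.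
    by rewrite (cardV x y xy exy) prednK; lia.
  - by lia.
  (* In the tight case every remaining vertex of outdegree [s.+1] must drop to [s], hence dominates
     both ends of the arc. *)
  - move=> le2s u du; have uX : u != x by apply: contraTneq dx => <-; rewrite du ltnn.
    have sub : [set v | (v != x) && (#|merge x y @: [set w | e v w]| <= s)]
       \subset [set v | (v != x) && (outdeg e v <= s.+1)].
      apply/subsetP => v; rewrite !inE => /andP[-> h].
      by apply: (leq_trans (card_merge_le xy [set w | e v w])).
    have /eqP eqX : [set v | (v != x) && (#|merge x y @: [set w | e v w]| <= s)]
       == [set v | (v != x) && (outdeg e v <= s.+1)].
      by rewrite eqEcard sub -numV //; lia.
    have : u \in [set v | (v != x) && (outdeg e v <= s.+1)] by rewrite inE uX du /=.
    rewrite -eqX inE uX /= -ltnS -du => /card_merge_lt.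
    by rewrite !inE.
have outE x : exists y, e x y by have /card_gt0P[y] := dT x; rewrite inE; exists y.
have [y0 xy0] := outE x0; have [bk b2s _] := red x0 y0 x0S xy0.
split=> //; rewrite ltnNge; apply/negP => le2s.
have dom x y u : x \in S -> e x y -> outdeg e u = s.+1 -> e u x && e u y.
  by move=> xS xy; case: (red x y xS xy) => _ _; apply.
(* From here on, [num_outdeg_le e s.+1 = 2 * s]; contract all of [S]. *)
have nsS A : #|A :\: S| <= 1 -> ~~ sinkless e A.
  by move=> A1; apply: contraL A1 => /P; rewrite ltnNge.
have aS : acyclic_on e S.
  move=> A sAS; apply: nsS; move: sAS; rewrite -setD_eq0 => /eqP ->.
  by rewrite cards0.
have [rho [rhoS rho1 rhoE]] := acyclic_retraction aS dT.
have rhoF v : (rho v == v) = (v \notin S).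
  by apply/eqP/idP => [<-|/rho1].
have rhoK v : rho (rho v) = rho v by apply: rho1.
have rho_arc v : rho v != v -> exists2 z, e v z & rho z = rho v.
  by rewrite rhoF negbK => /rhoE.
pose V := contract_vertex rho; pose e' : rel V := contract e (rho:=rho).
have ic' : intercyclic e' by apply: intercyclic_contract.
have valS (v : V) : val v \notin S by rewrite -rhoF (valP v).
have eI' : irreflexive e'.
  move=> v; have [vv|] := boolP (e' v v); last by move/negbTE.
  have : sinkless e' [set v] by rewrite -(setUid [set v]) two_cycle_sinkless.
  move/(sinkless_preim rho_arc) => sA; suff /nsS : #|[set u | rho u \in val @: [set v]] :\: S| <= 1.
    by rewrite sA.
  rewrite -(cards1 (val v)); apply: subset_leq_card; apply/subsetP => u.
  rewrite in_setD inE imset_set1 => /andP[uS]; rewrite rho1 //.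
have out' (v : V) : outdeg e (val v) <= #|S| + outdeg e' v.
  rewrite outdeg_contract // /outdeg -(cardsID S [set y | e (val v) y]).
  apply: leq_add; first by apply: subset_leq_card; apply: subsetIr.
  apply: subset_leq_card; apply/subsetP => y; rewrite inE => /andP[yS vy].
  by rewrite -(rho1 y yS) imset_f.
have large v : v \notin S -> s < outdeg e v by rewrite inE ltnNge.
(* It exists as [#|S| < s] while [2 * s] vertices have outdegree at most [s.+1]; by [dom] it
   dominates both ends of every arc leaving [S]. *)
have [u uU] : exists u, outdeg e u = s.+1.
  have : #|S| < num_outdeg_le e s.+1 by lia.
  rewrite ltnNge => /negP h.
  have [/existsP[u /eqP uU]|] := boolP [exists u, outdeg e u == s.+1]; first by exists u.
  rewrite negb_exists => /forallP no; case: h; apply: subset_leq_card.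
  by apply/subsetP => u; rewrite !inE leq_eqVlt (negPf (no u)).
have uS : u \notin S by rewrite inE uU ltnn.
have toV v : v \notin S -> exists v' : V, val v' = v.
  by rewrite -rhoF => rv; exists (exist _ v rv).
(* A common in-neighbour lying in [S] is lost in the contraction; [u] replaces it. *)
have com' p q : e' p q -> exists2 z, e' z p & e' z q.
  case/existsP=> w /andP[pw wq]; have [z zp zw] := com _ _ pw.
  have [z' [z'S z'p z'w]] : exists z', [/\ z' \notin S, e z' (val p) & e z' w].
    have [zS|zS] := boolP (z \in S); last by exists z.
    exists u; split=> //; first by case/andP: (dom z _ u zS zp uU).
    by case/andP: (dom z _ u zS zw uU).
  have [y yz] := toV z' z'S.
  exists y; apply/existsP; last by exists w; rewrite yz z'w.
  by exists (val p); rewrite yz z'p rhoF valS.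
have V0 : 0 < #|{: V}| by have [y _] := toV u uS; apply/card_gt0P; exists y.
have [|p pP] := common_in_neighbours_wheel ic' eI' _ com' V0.
  by move=> v; have := out' v; have := large _ (valS v); lia.
(* A rim vertex has [s < outdeg e v <= #|S| + 2] with [#|S| < s], so both bounds are tight. *)
have rim v : v \notin S -> v != val p -> outdeg e v <= s.+1 /\ s <= #|S|.+1.
  move=> vS vp; have [v' def_v] := toV v vS.
  have v'p : v' != p by apply: contraNneq vp => <-; rewrite def_v.
  have := out' v'; have := large _ (valS v'); have := pP v' v'p.
  by rewrite def_v; lia.
have sS : s <= #|S|.+1.
  have : 0 < #|~: (val p |: S)|.
    by have := cardsC (val p |: S); rewrite cardsU1 (valS p); lia.
  case/card_gt0P=> v; rewrite !in_setC in_setU1 negb_or => /andP[vp vS].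
  by case: (rim v vS vp).
(* A rim vertex [y] has outdegree [s.+1], so an arc from [S] to it would by [dom] give it a loop. *)
have outS x y : x \in S -> e x y -> y \in val p |: S.
  move=> xS xy; rewrite in_setU1; have [//|yp] := eqVneq y (val p).
  apply: contraT => yS; have [yle _] := rim y yS yp.
  have /(dom x y y xS xy)/andP[_] : outdeg e y = s.+1.
    by apply/eqP; rewrite eqn_leq yle large.
  by rewrite eI.
(* Some vertex of the acyclic set [S] has an arc to the hub; a hub of outdegree [s.+1] would then
   get a loop from [dom]. *)
have dp : s.+1 < outdeg e (val p).
  have /nsS : #|S :\: S| <= 1 by rewrite setDv cards0.
  rewrite /sinkless; have -> /= : S != set0 by apply/set0Pn; exists x0.
  case/forall_inPn => x xS /exists_inPn noS; have [y xy] := outE x.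
  have /setU1P[yp|yS] := outS x y xS xy; last by rewrite (negPf (noS y yS)) in xy.
  rewrite -yp ltn_neqAle large ?andbT; last by rewrite yp valS.
  apply/eqP => dy; have /andP[_] := dom x y y xS xy (esym dy).
  by rewrite eI.
(* Otherwise [val p |: S] is sinkless with just one vertex outside [S]. *)
have outp y : e (val p) y -> y \notin val p |: S.
  move=> py; apply/negP => yS; have /negP[] : ~~ sinkless e (val p |: S).
    apply: nsS; rewrite -(cards1 (val p)); apply: subset_leq_card.
    by apply/subsetP => v; rewrite in_setD in_setU1 in_set1 => /andP[/negPf ->]; rewrite orbF.
  apply/sinklessP; split; first by apply/set0Pn; exists y.
  move=> x /setU1P[->|xS]; first by exists y.
  by have [z xz] := outE x; exists z; rewrite // (outS x).
(* [S] and the out-neighbours of the hub give at least [(s - 1) + (s + 2)] vertices, more than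
   [2 * s]. *)
have : #|S| + outdeg e (val p) <= num_outdeg_le e s.+1; last by lia.
rewrite /num_outdeg_le -[X in _ <= X](cardsID S); apply: leq_add.
  apply: subset_leq_card; apply/subsetP => v vS; rewrite inE vS andbT inE.
  by apply: leqW; rewrite inE in vS.
apply: subset_leq_card; apply/subsetP => v; rewrite inE => /outp.
rewrite in_setU1 negb_or => /andP[vp vS]; rewrite inE vS inE.
by case: (rim v vS vp).
Qed.

(** With [a < r] vertices discarded, the previous bounds hold for [s - a]; adding the [a] vertices
    back turns [2 * (s - a) + 1] into [2 * s - a + 1], at least [2 * s - r + 2]. *)
Lemma outdeg_bounds_from_large (T : finType) (e : rel T) r s : intercyclic e ->
  0 < r <= s -> s <= #|T| ->
  num_outdeg_le e r.-1 < r -> num_outdeg_le e s < s ->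
  2 * s - r + 2 <= num_outdeg_le e s.+1 /\
  forall k, 2 * s - r + 2 <= k < #|T| -> k < num_outdeg_le e k.
Proof.
move=> ic /andP[r0 rs] sT numr nums.
(* [M] is the set of vertices that reach a dicycle. *)
pose M := [set v | [exists A : {set T}, sinkless e A && (v \in A)]].
have MP v : reflect (exists2 A : {set T}, sinkless e A & v \in A) (v \in M).
  rewrite inE; apply: (iffP existsP) => [[A /andP[sA vA]]|[A sA vA]]; exists A => //.
  by rewrite sA vA.
clearbody M; have aM : acyclic_on e (~: M).
  move=> A sAM; apply/negP => sA; have /sinklessP[/set0Pn[v vA] _] := sA.
  by have := subsetP sAM v vA; rewrite inE => /negP; apply; apply/MP; exists A.
have clM v y : v \notin M -> e v y -> y \notin M.
  move=> vM vy; apply: contra vM => /MP[A sA yA]; apply/MP; exists (v |: A); last exact: setU11.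
  case/sinklessP: sA => _ sA; apply/sinklessP; split.
    by apply/set0Pn; exists y; rewrite inE yA orbT.
  move=> u /setU1P[->|/sA[w wA uw]]; first by exists y; rewrite // inE yA orbT.
  by exists w; rewrite // inE wA orbT.
(* Among discarded vertices of outdegree above [k], a sink would have all its out-neighbours among
   the at most [k] vertices of outdegree at most [k]. *)
have subM k : num_outdeg_le e k <= k -> ~: M \subset [set v | outdeg e v <= k].
  move=> nk; rewrite -setD_eq0; apply: contraT => X0.
  have [v] := acyclic_sink (acyclic_onS (subsetDl _ _) aM) X0.
  rewrite in_setD in_setC => /andP[vk vM] vs; rewrite inE -ltnNge in vk.
  suff : outdeg e v <= num_outdeg_le e k by lia.
  apply: subset_leq_card; apply/subsetP => y; rewrite inE => vy.
  apply: contraT => yk; have /negP[] // : ~~ e v y.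
  by apply: vs; rewrite in_setD yk in_setC (clM v).
have ar : #|~: M| < r.
  apply: leq_ltn_trans (numr); apply: subset_leq_card; apply: subM.
  by rewrite -ltnS prednK.
pose V := {v : T | v \in M}; pose e' : rel V := relpre val e.
have sinkV (A : {set V}) : sinkless e' A -> sinkless e (val @: A).
  case/sinklessP=> /set0Pn[x xA] sA; apply/sinklessP; split.
    by apply/set0Pn; exists (val x); apply: imset_f.
  move=> _ /imsetP[v vA ->]; have [y yA vy] := sA v vA.
  by exists (val y); rewrite ?imset_f.
have ic' : intercyclic e'.
  move=> A B /sinkV sA /sinkV sB; apply: contra (ic _ _ sA sB) => dAB.
  rewrite disjoints_subset; apply/subsetP => _ /imsetP[v vA ->].
  rewrite inE mem_imset; last exact: val_inj.
  by move/pred0P: dAB => /(_ v) /=; rewrite vA /= => ->.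
have cardim (P : pred T) : #|[set v : V | P (val v)]| = #|[set v in M | P v]|.
  rewrite -(card_imset _ val_inj); apply: eq_card => v.
  apply/imsetP/idP => [[y]|]; first by rewrite !inE => Py ->; rewrite Py (valP y).
  by rewrite inE => /andP[vM Pv]; exists (exist _ v vM); rewrite // inE.
have cardV : #|{: V}| = #|T| - #|~: M|.
  have -> : #|{: V}| = #|M|.
    rewrite -cardsT -(card_imset _ val_inj); apply: eq_card => v.
    apply/imsetP/idP => [[y _ ->]|vM]; first exact: (valP y).
    by exists (exist _ v vM).
  by rewrite -(cardsC M) addnK.
have dV v : 0 < outdeg e' v.
  have /MP[A sA vA] := valP v; have /sinklessP[_ /(_ _ vA)[y yA vy]] := sA.
  have yM : y \in M by apply/MP; exists A.
  by apply/card_gt0P; exists (exist _ y yM); rewrite inE.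
have outV v : outdeg e (val v) <= outdeg e' v + #|~: M|.
  rewrite /outdeg (cardim (fun y => e (val v) y)) -(cardsID M [set y | e (val v) y]).
  apply: leq_add; apply: subset_leq_card; apply/subsetP => y.
    by rewrite !inE andbC.
  by rewrite in_setD in_setC => /andP[].
have numV k : s <= k + #|~: M| ->
    num_outdeg_le e' k + #|~: M| <= num_outdeg_le e (k + #|~: M|).
  move=> sk; rewrite /num_outdeg_le -[X in _ <= X](cardsID M); apply: leq_add.
    rewrite -(card_imset _ val_inj); apply: subset_leq_card; apply/subsetP => _ /imsetP[v vk ->].
    rewrite inE (valP v) andbT inE; apply: leq_trans (outV v) _.
    by rewrite inE in vk; rewrite leq_add2r.
  apply: subset_leq_card; apply/subsetP => v vM; rewrite in_setD; rewrite in_setC in vM.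
  rewrite vM inE; apply: leq_trans sk; have := subsetP (subM s (ltnW nums)) v.
  by rewrite in_setC vM inE => ->.
have [||b1 b2] := outdeg_bounds (s := s - #|~: M|) ic' dV.
- by rewrite cardV; lia.
- by have := numV (s - #|~: M|); rewrite subnK; lia.
have n1 := numV (s - #|~: M|).+1.
rewrite addSn subnK in n1; last by lia.
have n2 : 2 * s - #|~: M| < num_outdeg_le e s.+1 by lia.
split; first by lia.
(* Values of [k] too small for [b2] follow from the count for [s.+1] by monotonicity. *)
move=> k /andP[tk kT]; have [k1|k1] := leqP k (2 * s - #|~: M|).
  by apply: leq_trans (num_outdeg_leS e (_ : s.+1 <= k)); lia.
have := numV (k - #|~: M|); rewrite subnK; last by lia.
have := b2 (k - #|~: M|); rewrite cardV; lia.
Qed.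

Lemma term_le (d : seq nat) i k : sorted leq d -> 0 < i <= size d ->
  (term d i <= k) = (i <= count (leq^~ k) d).
Proof.
case: i => // i; rewrite /term /= => + lti; elim: d i lti => // x d IH i lti /= ds.
have /allP xd : all (leq x) d by apply: order_path_min ds; exact: leq_trans.
have [xk|xk] := leqP x k.
  by case: i lti => //= i lti; rewrite IH ?(path_sorted ds).
have -> : count (leq^~ k) d = 0.
  apply/eqP; rewrite -leqn0 leqNgt -has_count; apply/hasPn => y /xd xy.
  by rewrite -ltnNge; apply: leq_trans xk xy.
case: i lti => [|i] lti /=; first by lia.
by have := xd (nth 0 d i) (mem_nth 0 (lti : i < size d)); lia.
Qed.

Lemma count_outdeg_seq (T : finType) (e : rel T) k :
  count (leq^~ k) (outdeg_seq e) = num_outdeg_le e k.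
Proof.
rewrite /outdeg_seq count_sort count_map -size_filter /num_outdeg_le cardE.
apply: perm_size; apply: uniq_perm; rewrite ?enum_uniq //.
  by rewrite filter_uniq // enum_uniq.
by move=> v; rewrite mem_filter !mem_enum !inE andbT.
Qed.

(** In an intercyclic digraph the two bounds refute the last clause of [large]: the first gives its
    premises, the second excludes every [j]. *)
Lemma large_two_disjoint_cycles (T : finType) (e : rel T) :
  large (outdeg_seq e) -> two_disjoint_cycles e.
Proof.
have [//|ic] := two_disjoint_cycles_or_intercyclic e.
set d := outdeg_seq e => -[r [s [[/andP[r0 rs] sd] [dr ds] lt]]].
have ds_sorted : sorted leq d by apply: sort_sorted; exact: leq_total.
have dT : size d = #|T| by rewrite size_sort size_map cardE enumT.
have termE i k : 0 < i <= size d -> (term d i <= k) = (i <= num_outdeg_le e k).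
  by move=> h; rewrite term_le // count_outdeg_seq.
have nr : num_outdeg_le e r.-1 < r by rewrite ltnNge -termE; lia.
have ns : num_outdeg_le e s < s by rewrite ltnNge -termE; lia.
have [||b1 b2] := outdeg_bounds_from_large ic _ _ nr ns; rewrite -?dT ?r0 //.
have td : 2 * s - r + 2 <= size d by rewrite dT (leq_trans b1) // max_card.
case: lt => //.
  apply/eqP; rewrite addn1 eqn_leq termE ?b1 /=; last by lia.
  rewrite ltnNge termE; lia.
move=> j /andP[tj jd] dj; have := b2 j.-1; have := termE j j.-1; lia.
Qed.

(** * Realising sequences that are not large *)

Lemma card_ord_seq n (s : seq nat) : uniq s -> all (gtn n) s ->
  #|[set y : 'I_n | val y \in s]| = size s.
Proof.
move=> us /allP sn; rewrite cardE -(size_map val); apply: perm_size.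
apply: uniq_perm => //; first by rewrite (map_inj_uniq val_inj) enum_uniq.
move=> k; apply/mapP/idP => [[y]|ks]; first by rewrite mem_enum inE => ? ->.
by exists (Ordinal (sn k ks)); rewrite ?mem_enum ?inE.
Qed.

(** Long enough lists [nbrs] allow any prescribed outdegrees, while intercyclicity is checked on the
    full lists. *)
Definition truncated_arcs n (d : seq nat) (nbrs : nat -> seq nat) : rel 'I_n :=
  fun x y => val y \in take (nth 0 d x) (nbrs x).

Lemma truncated_arcs_outdeg_seq n (d : n.-tuple nat) nbrs : sorted leq d ->
  (forall i, i < n -> [/\ uniq (nbrs i), all (gtn n) (nbrs i) &
                          nth 0 d i <= size (nbrs i)]) ->
  outdeg_seq (@truncated_arcs n d nbrs) = d.
Proof.
move=> ds nbP; rewrite /outdeg_seq.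
suff -> : [seq outdeg (truncated_arcs d nbrs) x | x : 'I_n] = d.
  by apply: sorted_sort => //; exact: leq_trans.
have -> : [seq outdeg (truncated_arcs d nbrs) x | x : 'I_n] =
    [seq nth 0 d (val x) | x <- enum 'I_n].
  rewrite /image_mem; apply: eq_map => x; have [u a l] := nbP x (ltn_ord x).
  rewrite /outdeg card_ord_seq ?take_uniq ?size_takel //.
  by apply/allP => k /mem_take; apply/allP.
rewrite (map_comp (nth 0 d) val) val_enum_ord -[RHS](mkseq_nth 0) size_tuple.
by [].
Qed.

Lemma ord_sinkless_min n (e : rel 'I_n) A : sinkless e A ->
  exists2 m, m \in A & forall v, v \in A -> m <= v.
Proof.
case/sinklessP => /set0Pn[x xA] _.
by have [m mA mP] := arg_minnP (fun v : 'I_n => val v) xA; exists m.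
Qed.

(** The least vertex of a sinkless set has no smaller out-neighbour in it, so it is the hub or has
    an arc to it: all sinkless sets share [h]. *)
Lemma hub_intercyclic n (h : nat) (e : rel 'I_n) :
  (forall x y : 'I_n, e x y -> x <> h :> nat -> y < x \/ y = h :> nat) ->
  intercyclic e.
Proof.
move=> eP; have hA A : sinkless e A -> exists2 x : 'I_n, x \in A & x = h :> nat.
  move=> sA; have [m mA mP] := ord_sinkless_min sA.
  have [mh|mh] := eqVneq (m : nat) h; first by exists m.
  have /sinklessP[_ /(_ m mA)[y yA my]] := sA.
  have [lt|yh] := eP m y my (elimN eqP mh); last by exists y.
  by have := mP y yA; rewrite leqNgt lt.
move=> A B /hA[x xA xh] /hA[y yB yh]; apply/negP => /pred0P/(_ x) /=.
by rewrite xA (_ : x = y) ?yB //; apply: val_inj; rewrite /= xh yh.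
Qed.

(* The wheel has hub [s] and rim [s+1, ..., t]; indices are 0-based. *)
Definition wheel_next s t i := if i == t then s.+1 else i.+1.

(** Inspecting its least vertex, a sinkless set contains the hub and a rim vertex, or the whole rim;
    any two such sets meet. *)
Lemma wheel_intercyclic n (e : rel 'I_n) r s t : s < t < n ->
  (forall x y : 'I_n, e x y -> x < r -> y < x) ->
  (forall x y : 'I_n, e x y -> r <= x < s -> y < x \/ y = s :> nat) ->
  (forall x y : 'I_n, e x y -> x = s :> nat -> y < r \/ s < y <= t) ->
  (forall x y : 'I_n, e x y -> s < x <= t ->
     y <= s \/ y = wheel_next s t x :> nat) ->
  (forall x y : 'I_n, e x y -> t < x -> y < x) ->
  intercyclic e.
Proof.
move=> /andP[st tn] e1 e2 e3 e4 e5.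
pose has_rim (A : {set 'I_n}) := forall v : 'I_n, s < v <= t -> v \in A.
have alt A : sinkless e A ->
    (exists x y : 'I_n, [/\ x \in A, x = s :> nat, y \in A & s < y <= t]) \/ has_rim A.
  move=> sA; have [m mA mP] := ord_sinkless_min sA.
  have /sinklessP[_ out] := sA; have [y yA my] := out m mA.
  have ym := mP y yA.
  have mr : r <= m by rewrite leqNgt; apply/negP => /(e1 m y my); lia.
  have mt : m <= t by rewrite leqNgt; apply/negP => /(e5 m y my); lia.
  have hub x : x \in A -> x = s :> nat ->
      exists x y : 'I_n, [/\ x \in A, x = s :> nat, y \in A & s < y <= t].
    move=> xA xs; have [z zA xz] := out x xA; exists x, z; split=> //.
    by case: (e3 x z xz xs) => //; have := mP z zA; lia.
  have [ms|ms|ms] := ltngtP m s; last by left; apply: (hub m).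
    left; apply: (hub y) => //.
    by case: (e2 m y my) => [|lt|//]; [rewrite mr | lia].
  right.
  have nextA v : v \in A -> s < v <= t ->
      exists2 w : 'I_n, w \in A & w = wheel_next s t v :> nat.
    move=> vA vst; have [w wA vw] := out v vA; exists w => //.
    by case: (e4 v w vw vst) => //; have := mP w wA; lia.
  (* Used twice: from [m] up to [t], then, after wrapping around, from [s.+1] over the whole rim. *)
  have up i k : s < i -> (exists2 v : 'I_n, v \in A & v = i :> nat) -> i + k <= t ->
      exists2 v : 'I_n, v \in A & v = i + k :> nat.
    move=> si vi; elim: k => [|k IH] ikt; first by rewrite addn0.
    have [|v vA vE] := IH; first lia.
    have [|w wA wE] := nextA v vA; first by lia.
    exists w => //; rewrite wE /wheel_next; case: eqP; lia.
  have [|v vA vt] := up m (t - m) ms (ex_intro2 _ _ m mA erefl); first lia.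
  have [|w wA wE] := nextA v vA; first by lia.
  have ws : w = s.+1 :> nat by rewrite wE /wheel_next; case: eqP; lia.
  move=> x /andP[sx xt].
  have [||z zA zx] := up s.+1 (x - s.+1) _ (ex_intro2 _ _ w wA ws); try lia.
  by rewrite (_ : x = z) //; apply: val_inj => /=; lia.
move=> A B /alt hA /alt hB; apply/negP => /pred0P dAB.
have dis (x y : 'I_n) : x \in A -> y \in B -> x <> y :> nat.
  move=> xA yB /val_inj xy; have := dAB x; by rewrite /= xA xy yB.
case: hA => [[x [y [xA xs yA yst]]]|rA]; case: hB => [[x' [y' [xB xs' yB yst']]]|rB].
- by apply: (dis x x'); rewrite // xs.
- by apply: (dis y y) => //; apply: rB.
- by apply: (dis y' y') => //; apply: rA.
- by apply: (dis (Ordinal tn) (Ordinal tn)) => //; [apply: rA | apply: rB]; rewrite /= st /=.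
Qed.

Lemma not_forcing n (d : n.-tuple nat) nbrs : sorted leq d ->
  (forall i, i < n -> [/\ uniq (nbrs i), all (gtn n) (nbrs i) &
                          nth 0 d i <= size (nbrs i)]) ->
  intercyclic (@truncated_arcs n d nbrs) ->
  ~ (forall (T : finType) (e : rel T),
      #|T| = n -> outdeg_seq e = d -> two_disjoint_cycles e).
Proof.
move=> ds nbP ic /(_ _ (truncated_arcs d nbrs) (card_ord n)) H.
by apply: (intercyclic_no2 ic); apply: H; apply: truncated_arcs_outdeg_seq.
Qed.

Lemma truncated_arcsP n (d : seq nat) nbrs (x y : 'I_n) :
  truncated_arcs d nbrs x y -> (y : nat) \in nbrs x.
Proof. exact: mem_take. Qed.

Lemma forced_large n (d : n.-tuple nat) : 0 < n -> sorted leq d ->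
  (forall (T : finType) (e : rel T),
      #|T| = n -> outdeg_seq e = d -> two_disjoint_cycles e) -> large d.
Proof.
move=> n0 ds forced.
have dn i : n <= i -> nth 0 d i = 0 by move=> ni; rewrite nth_default // size_tuple.
have dle i j : i <= j < n -> nth 0 d i <= nth 0 d j.
  case/andP=> ij jn; apply: (sorted_leq_nth leq_trans leqnn 0 ds) => //.
    by rewrite inE size_tuple; lia.
  by rewrite inE size_tuple.
have [/existsP[s1 s1P]|no_s] := boolP [exists i : 'I_n, i.+1 < nth 0 d i]; last first.
  (* Here [d] at the 0-based index [i] is at most [i.+1]: the smaller indices and the hub [n.-1]
     suffice. *)
  exfalso; pose nbrs i := if i == n.-1 then iota 0 n else n.-1 :: iota 0 i.
  apply: (@not_forcing n d nbrs) => //.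
    move=> i lin; rewrite /nbrs; have di : nth 0 d i <= i.+1.
      by rewrite leqNgt; apply: contra no_s => h; apply/existsP; exists (Ordinal lin).
    case: eqP => ih.
      rewrite iota_uniq size_iota; split=> //; last by lia.
      by apply/allP => k; rewrite mem_iota /=; lia.
    rewrite /= mem_iota iota_uniq size_iota; split=> //; first by lia.
    by apply/andP; split; [lia | apply/allP => k; rewrite mem_iota /=; lia].
  apply: (@hub_intercyclic _ n.-1) => x y /truncated_arcsP; rewrite /nbrs.
  by case: eqP => // _; rewrite inE mem_iota /= => /orP[/eqP ->|? _]; [right | left; lia].
have ex_s : exists i, i.+1 < nth 0 d i by exists s1.
(* Least choices, 0-based: [r.+1] and [s.+1] are the indices in [large]. Either they are witnesses,
   or minimality bounds all terms for the wheel. *)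
case: (ex_minnP ex_s) => s sP smin {s1 s1P ex_s}.
have ex_r : exists i, i < nth 0 d i by exists s; lia.
case: (ex_minnP ex_r) => r rP rmin {ex_r}.
have rs : r <= s by apply: rmin; lia.
have sn : s < n by rewrite ltnNge; apply/negP => /dn; lia.
pose t := 2 * s - r + 2.
have [good|] := boolP [|| n <= t, nth 0 d t != s.+2 |
    has (fun j => j < nth 0 d j) (iota t.+1 (n - t.+1))].
  exists r.+1, s.+1; rewrite /term size_tuple /= addn1.
  have -> : 2 * s.+1 - r.+1 + 2 = t.+1 by rewrite /t; lia.
  have -> : 2 * s.+1 - r.+1 + 3 = t.+2 by rewrite /t; lia.
  split; [by [] | by [] |] => /= tn dt.
  case/or3P: good => [|/eqP//|/hasP[j]]; first by lia.
  by rewrite mem_iota => jt dj; exists j.+1; rewrite //=; lia.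
rewrite !negb_or negbK -ltnNge => /and3P[tn /eqP dt /hasPn small]; exfalso.
(* List lengths match the bounds [d1] to [d4]. The rim has [t - s = s - r + 2] vertices, so the hub
   reaches [r + (s - r + 2) = s.+2], and so does a rim vertex with [1 + s.+1]. *)
pose nbrs i := if i < r then iota 0 i else if i < s then s :: iota 0 i else
  if i == s then iota 0 r ++ iota s.+1 (s - r + 2) else
  if i <= t then wheel_next s t i :: iota 0 s.+1 else iota 0 i.
have d1 i : i < r -> nth 0 d i <= i.
  by move=> ir; rewrite leqNgt; apply/negP => /rmin; lia.
have d2 i : i < s -> nth 0 d i <= i.+1.
  by move=> is_; rewrite leqNgt; apply/negP => /smin; lia.
have d3 i : s <= i <= t -> nth 0 d i <= s.+2.
  by case/andP=> _ it; rewrite -dt; apply: dle; rewrite it.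
have d4 i : t < i -> nth 0 d i <= i.
  move=> ti; have [ni|ni] := leqP n i; first by rewrite dn.
  by have := small i; rewrite mem_iota; lia.
apply: (@not_forcing n d nbrs) => //.
  move=> i lin; rewrite /nbrs.
  have allI k : k <= n -> all (gtn n) (iota 0 k).
    by move=> kn; apply/allP => j; rewrite mem_iota /=; lia.
  case: ltnP => ir.
    by rewrite iota_uniq size_iota allI ?d1 //; lia.
  case: ltnP => is_.
    rewrite /= mem_iota iota_uniq size_iota allI ?d2 //; last by lia.
    by split=> //; lia.
  case: eqP => si.
    rewrite cat_uniq !iota_uniq all_cat allI ?size_cat ?size_iota; last by lia.
    split; last by have := d3 i; rewrite /t; lia.
      rewrite /= andbT; apply/hasPn => j; rewrite !mem_iota; lia.
    by apply/allP => j; rewrite mem_iota /= /t in tn *; lia.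
  case: leqP => it.
    have wn : s < wheel_next s t i < n by rewrite /wheel_next; case: eqP; lia.
    move: wn (d3 i); move: (wheel_next s t i) => w wn d3i; split.
    - by rewrite cons_uniq mem_iota iota_uniq; lia.
    - apply/allP => j; rewrite inE mem_iota /= => jw; lia.
    - by rewrite -[size _]/(size (iota 0 s.+1)).+1 size_iota; lia.
  by rewrite iota_uniq size_iota allI ?d4 //; lia.
have st : s < t < n by rewrite tn /t; lia.
apply: (@wheel_intercyclic n _ r s t st) => x y /truncated_arcsP; rewrite /nbrs.
- by move=> + xr; rewrite xr mem_iota; lia.
- by move=> + /andP[rx xs]; rewrite ltnNge rx xs /= inE mem_iota => /orP[/eqP ->|]; [right | left; lia].
- move=> + xs; rewrite xs ltnNge rs ltnn eqxx mem_cat !mem_iota /t /=; lia.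
- move=> + /andP[sx xt]; rewrite (_ : (x < r) = false); last by lia.
  rewrite (_ : (x < s) = false); last by lia.
  rewrite (_ : (nat_of_ord x == s) = false); last by lia.
  by rewrite xt inE => /orP[/eqP ->|]; [right | rewrite mem_iota; left; lia].
- move=> + tx; have ->: (x <= t) = false by lia.
  have tr : r <= t by lia.
  have [xr|xr] := ltnP x r; first by lia.
  have [xr'|xr'] := ltnP x s; first by lia.
  have [xr''|xr''] := eqVneq (x : nat) s; first by lia.
  by rewrite mem_iota; lia.
Qed.

Theorem theorem1p4 (n : nat) (d : n.-tuple nat) (n_gt0 : 0 < n)
    (d_sorted : sorted leq d) :
  (forall (T : finType) (e : rel T),
      #|T| = n -> outdeg_seq e = d -> two_disjoint_cycles e)
  <-> large d.
Proof.
split; first exact: forced_large.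
by move=> dl T e _ de; apply: large_two_disjoint_cycles; rewrite de.
Qed.
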